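(* Let $A$ be the twisted symmetric algebra of a finite group $G$ over the subalgebra $\bar{A}$, in the setting of the context (in particular $K=F$). If the group $G$ is cyclic, then there exists a bijection $$\mathrm{Bl}(\bar{A})/G\ \longleftrightarrow\ \mathrm{Bl}(A)/G^\vee,\qquad \bar{\mathcal{Y}}\leftrightarrow\mathcal{Y}$$ such that $\bar{b}(\bar{\mathcal{Y}})=b(\mathcal{Y})$, i.e., $$\mathrm{Tr}(G,\bar{b})=\mathrm{Tr}(G^\vee,b)\quad\text{for all }\bar{b}\in\bar{\mathcal{Y}}\text{ and }b\in\mathcal{Y}.$$ In particular, the algebras $(Z\bar{A})^G$ and $(ZA)^{G^\vee}$ have the same blocks.
   Context: Setting. $\mathcal{O}$ is a Noetherian integrally closed domain with field of fractions $F=K$; $A$ is an $\mathcal{O}$-algebra, free and finitely generated as an $\mathcal{O}$-module, with a symmetrizing form $t$ (an $\mathcal{O}$-linear map $t:A\to\mathcal{O}$ with $t(ab)=t(ba)$ such that $a\mapsto(x\mapsto t(ax))$ is an isomorphism $A\to\mathrm{Hom}_{\mathcal{O}}(A,\mathcal{O})$). A subalgebra $\bar A$ is a symmetric subalgebra if $\bar A$ is free of finite rank over $\mathcal{O}$, the restriction of $t$ to $\bar A$ is a symmetrizing form on $\bar A$, and $A$ is free of finite rank as a left $\bar A$-module. $A$ is the twisted symmetric algebra of the finite group $G$ over $\bar A$ if $\bar A$ is a symmetric subalgebra of $A$ and there are $\mathcal{O}$-submodules $(A_g)_{g\in G}$ of $A$ with $A=\bigoplus_{g\in G}A_g$, $A_gA_h=A_{gh}$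 for all $g,h\in G$, $A_1=\bar A$, and $t(A_g)=0$ for $g\neq 1$. For each $g$ there is a unit $a_g$ of $A$ lying in $A_g$ with $A_g=a_g\bar A=\bar A a_g$; these are fixed, with $a_1=1$. The algebras $KA:=K\otimes_{\mathcal{O}}A$ and $K\bar A$ are split semisimple, and all group algebras over $K$ considered are split semisimple. $ZA$ denotes the center of $A$. The blocks of an algebra are its central primitive idempotents; $\mathrm{Bl}(A)$ and $\mathrm{Bl}(\bar A)$ are the sets of blocks of $A$ and $\bar A$. $G$ acts on $Z\bar A$ by $g(z)=a_gza_g^{-1}$, hence on $\mathrm{Bl}(\bar A)$. $G^\vee:=\mathrm{Hom}(G,K^\times)$ acts on $A$ by $\xi\cdot(\bar aa_g):=\xi(g)\bar aa_g$ for $\bar a\in\bar A$, $g\in G$, hence on $\mathrm{Bl}(A)$. $(Z\bar A)^G$ and $(ZA)^{G^\vee}$ are the algebras of fixed points. For $\bar b\in\mathrm{Bl}(\bar A)$ with stabilizer $G_{\bar b}$, $\mathrm{Tr}(G,\bar b):=\sum_{g\in G/G_{\bar b}}g(\bar b)$; for $b\in\mathrm{Bl}(A)$ with stabilizer $(G^\vee)_b$, $\mathrm{Tr}(G^\vee,b):=\sum_{\xi\in G^\vee/(G^\vee)_b}\xi\cdot b$. For an orbit $\bar{\mathcal Y}$ of $G$ on $\mathrm{Bl}(\bar A)$, $\bar b(\bar{\mathcal Y}):=\sum_{\bar b\in\bar{\mathcal Y}}\bar b$; for an orbit $\mathcal Y$ of $G^\vee$ on $\mathrm{Bl}(A)$,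 $b(\mathcal Y):=\sum_{b\in\mathcal Y}b$. *)

(* Defs.v *)
From HB Require Import structures.
From mathcomp Require Import all_boot all_order all_algebra all_fingroup all_solvable.
From mathcomp Require Import boolp classical_sets functions cardinality fsbigop.
Set Implicit Arguments.
Unset Strict Implicit.
Unset Printing Implicit Defensive.

Import GRing.Theory.

Local Open Scope classical_set_scope.
Local Open Scope ring_scope.

(* Subsets that are only tested for membership in a module or an algebra are  *)
(* boolean predicates, as in MathComp; sets of blocks, orbits and fixed       *)
(* points are classical sets.                                                 *)

Definition finitely_generated (R : pzRingType) (V : lmodType R)
    (S : {pred V}) : Prop :=
  exists (n : nat) (e : 'I_n -> V),
    forall v, v \in S <-> exists c : 'I_n -> R, v = \sum_(i < n) c i *: e i.

(* [scale] is an explicit argument because a ring is not canonically a module *)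
(* over its subrings.                                                         *)
Definition free_of_finite_rank (R : Type) (M : nmodType)
    (scale : R -> M -> M) : Prop :=
  exists (n : nat) (e : 'I_n -> M),
    forall x, exists! c : {ffun 'I_n -> R}, x = \sum_(i < n) scale (c i) (e i).

Definition simple_submodule (R : pzRingType) (V : lmodType R)
    (S : {pred V}) : Prop :=
  [/\ submod_closed S, exists2 v, v \in S & v != 0 &
      forall T : {pred V}, submod_closed T -> {subset T <= S} ->
        (forall v, v \in T -> v = 0) \/ {subset S <= T}].

Definition simple_module (R : pzRingType) (V : lmodType R) : Prop :=
  simple_submodule (predT : {pred V}).

Definition semisimple_module (R : pzRingType) (V : lmodType R) : Prop :=
  forall v : V, exists (n : nat) (S : 'I_n -> {pred V}) (w : 'I_n -> V),
    (forall i, simple_submodule (S i) /\ w i \in S i) /\ v = \sum_(i < n) w i.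

Definition semisimple (R : pzRingType) : Prop := semisimple_module R^o.

Definition split_algebra (K : fieldType) (B : algType K) : Prop :=
  forall V : lmodType B, simple_module V ->
    forall f : {linear V -> V}, exists c : K, forall v, f v = (c%:A : B) *: v.

Definition split_semisimple (K : fieldType) (B : algType K) : Prop :=
  semisimple B /\ split_algebra B.

Definition noetherian (O : idomainType) : Prop :=
  forall I : {pred O^o}, submod_closed I -> finitely_generated I.

Definition integrally_closed (O : idomainType) : Prop :=
  forall x : {fraction O}, integralOver (@tofrac O) x ->
    exists o : O, x = tofrac o.

(* The universal property of K (x)_O A, where i a stands for 1 (x) a; as i is *)
(* also a ring morphism into a K-algebra, it fixes the algebra structure.     *)
Definition is_scalar_extension (O : idomainType) (A : algType O)
    (KA : algType {fraction O})
    (i : {lrmorphism A -> KA | @tofrac O \; *:%R}) : Prop :=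
  forall (V : lmodType {fraction O}) (f : {linear A -> V | @tofrac O \; *:%R}),
    (exists g : {linear KA -> V}, forall a, g (i a) = f a) /\
    (forall g h : {linear KA -> V}, (forall a, g (i a) = h (i a)) -> g =1 h).

Definition split_semisimple_over_fractions (O : idomainType) (A : algType O) :
    Prop :=
  exists (KA : algType {fraction O})
         (i : {lrmorphism A -> KA | @tofrac O \; *:%R}),
    is_scalar_extension i /\ split_semisimple KA.

Section GroupAlgebra.
Variables (K : fieldType) (gT : finGroupType).

(* f stands for \sum_g f g *: g. *)
Definition group_algebra : Type := {ffun gT -> K^o}.
HB.instance Definition _ := GRing.Lmodule.copy group_algebra {ffun gT -> K^o}.

Definition ga_one : group_algebra := [ffun g => (g == 1%g)%:R].
Definition ga_mul (f h : group_algebra) : group_algebra :=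
  [ffun g => \sum_(x : gT) f x * h (x^-1 * g)%g].

Fact ga_mulA : associative ga_mul.
Proof.
move=> f h k; apply/ffunP => g; rewrite !ffunE.
under eq_bigr => x _ do rewrite ffunE mulr_sumr.
under [RHS]eq_bigr => x _ do rewrite ffunE mulr_suml.
rewrite [RHS]exchange_big /=; apply: eq_bigr => x _.
rewrite [RHS](reindex (fun y => (x * y)%g)) /=; last first.
  by exists (fun y => (x^-1 * y)%g) => y _; rewrite (mulKg, mulKVg).
by apply: eq_bigr => y _; rewrite mulKg invMg !mulgA mulrA.
Qed.

Fact ga_mul1r : left_id ga_one ga_mul.
Proof.
move=> f; apply/ffunP => g; rewrite ffunE (bigD1 1%g) //= ffunE eqxx mul1r.
rewrite invg1 mul1g big1 ?addr0 // => x /negPf nx.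
by rewrite ffunE nx mul0r.
Qed.

Fact ga_mulr1 : right_id ga_one ga_mul.
Proof.
move=> f; apply/ffunP => g; rewrite ffunE (bigD1 g) //= ffunE mulVg eqxx mulr1.
rewrite big1 ?addr0 // => x nx; rewrite ffunE -(inj_eq (mulgI x)) mulKVg mulg1.
by rewrite eq_sym (negPf nx) mulr0.
Qed.

Fact ga_mulDl : left_distributive ga_mul +%R.
Proof.
move=> f h k; apply/ffunP => g; rewrite !ffunE -big_split /=.
by apply: eq_bigr => x _; rewrite ffunE mulrDl.
Qed.

Fact ga_mulDr : right_distributive ga_mul +%R.
Proof.
move=> f h k; apply/ffunP => g; rewrite !ffunE -big_split /=.
by apply: eq_bigr => x _; rewrite ffunE mulrDr.
Qed.

Fact ga_one_neq0 : ga_one != 0.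
Proof.
by apply/eqP => /ffunP/(_ 1%g); rewrite !ffunE eqxx => /eqP; rewrite oner_eq0.
Qed.

HB.instance Definition _ := GRing.Zmodule_isNzRing.Build group_algebra
  ga_mulA ga_mul1r ga_mulr1 ga_mulDl ga_mulDr ga_one_neq0.

Fact ga_scalerAl (c : K) (f h : group_algebra) : c *: (f * h) = (c *: f) * h.
Proof.
apply/ffunP => g; rewrite !ffunE scaler_sumr.
by apply: eq_bigr => x _; rewrite ffunE scalerAl.
Qed.

HB.instance Definition _ :=
  GRing.Lmodule_isLalgebra.Build K group_algebra ga_scalerAl.

Fact ga_scalerAr (c : K) (f h : group_algebra) : c *: (f * h) = f * (c *: h).
Proof.
apply/ffunP => g; rewrite !ffunE scaler_sumr.
by apply: eq_bigr => x _; rewrite ffunE scalerAr.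
Qed.

HB.instance Definition _ :=
  GRing.Lalgebra_isAlgebra.Build K group_algebra ga_scalerAr.

End GroupAlgebra.

Section DualGroup.
Variables (K : fieldType) (gT : finGroupType).

Definition is_linear_character (xi : {ffun gT -> K}) : bool :=
  [forall g, xi g != 0] &&
  [forall g, forall h, xi (g * h)%g == xi g * xi h].

Record dual_group : Type := DualGroup {
  dual_fun :> {ffun gT -> K};
  _ : is_linear_character dual_fun
}.

HB.instance Definition _ := [isSub for dual_fun].
HB.instance Definition _ := [Choice of dual_group by <:].

Fact dual_oneP : is_linear_character [ffun => 1].
Proof.
apply/andP; split; apply/forallP => g; first by rewrite ffunE oner_neq0.
by apply/forallP => h; rewrite !ffunE mulr1.
Qed.

Fact dual_mulP (xi eta : dual_group) :
  is_linear_character [ffun g => xi g * eta g].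
Proof.
case: xi eta => xi /andP[xi0 xiM] [eta /andP[eta0 etaM]] /=.
apply/andP; split; apply/forallP => g.
  by rewrite ffunE mulf_neq0 ?(forallP xi0) ?(forallP eta0).
apply/forallP => h; rewrite !ffunE (eqP (forallP (forallP xiM g) h)).
by rewrite (eqP (forallP (forallP etaM g) h)) mulrACA.
Qed.

Fact dual_invP (xi : dual_group) : is_linear_character [ffun g => (xi g)^-1].
Proof.
case: xi => xi /andP[xi0 xiM] /=; apply/andP; split; apply/forallP => g.
  by rewrite ffunE invr_eq0 (forallP xi0).
by apply/forallP => h; rewrite !ffunE (eqP (forallP (forallP xiM g) h)) invfM.
Qed.

Definition dual_one := DualGroup dual_oneP.
Definition dual_mul xi eta := DualGroup (dual_mulP xi eta).
Definition dual_inv xi := DualGroup (dual_invP xi).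

Fact dual_mulA : associative dual_mul.
Proof. by move=> x y z; apply/val_inj/ffunP => g; rewrite !ffunE mulrA. Qed.

Fact dual_mul1g : left_id dual_one dual_mul.
Proof. by move=> x; apply/val_inj/ffunP => g; rewrite !ffunE mul1r. Qed.

Fact dual_mulVg : left_inverse dual_one dual_inv dual_mul.
Proof.
move=> x; apply/val_inj/ffunP => g; rewrite !ffunE mulVf //.
by case: x => x /= /andP[/forallP].
Qed.

Fact dual_mulg1 : right_id dual_one dual_mul.
Proof. by move=> x; apply/val_inj/ffunP => g; rewrite !ffunE mulr1. Qed.

Fact dual_mulgV : right_inverse dual_one dual_inv dual_mul.
Proof.
move=> x; apply/val_inj/ffunP => g; rewrite !ffunE mulfV //.
by case: x => x /= /andP[/forallP].
Qed.

HB.instance Definition _ := isGroup.Build dual_group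
  dual_mulA dual_mul1g dual_mulg1 dual_mulVg dual_mulgV.

End DualGroup.

Definition symmetrizing_form (O : idomainType) (A : algType O)
    (t : {scalar A}) : Prop :=
  (forall a b, t (a * b) = t (b * a)) /\
  (forall f : {scalar A}, exists! a, forall x, f x = t (a * x)).

(* The subalgebra is given both as a membership predicate P on A and as the   *)
(* subtype Abar of its elements, which has its own algebra structure.         *)
Definition symmetric_subalgebra (O : idomainType) (A : algType O)
    (t : {scalar A}) (P : {pred A}) (Abar : subAlgType P) : Prop :=
  [/\ free_of_finite_rank (fun (o : O) (x : Abar) => o *: x),
      symmetrizing_form (t \o (val : Abar -> A)) &
      free_of_finite_rank (fun (x : Abar) (a : A) => val x * a)].

(* Products of two submodules consist of finite sums of products. *)
Definition in_product (A : pzRingType) (S T : {pred A}) (x : A) : Prop :=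
  exists (n : nat) (u v : 'I_n -> A),
    (forall i, u i \in S /\ v i \in T) /\ x = \sum_(i < n) u i * v i.

Definition twisted_symmetric_algebra (O : idomainType) (A : algType O)
    (t : {scalar A}) (P : {pred A}) (Abar : subAlgType P)
    (gT : finGroupType) (Ag : gT -> {pred A}) : Prop :=
  symmetric_subalgebra t Abar /\
  [/\ forall g, submod_closed (Ag g),
      forall x, exists! c : {ffun gT -> A},
        (forall g, c g \in Ag g) /\ x = \sum_(g : gT) c g,
      forall g h x, x \in Ag (g * h)%g <-> in_product (Ag g) (Ag h) x,
      Ag 1%g =i P &
      forall g x, g != 1%g -> x \in Ag g -> t x = 0].

Definition graded_units (O : idomainType) (A : unitAlgType O) (P : {pred A})
    (gT : finGroupType) (Ag : gT -> {pred A}) (a : gT -> A) : Prop :=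
  a 1%g = 1 /\
  forall g, [/\ a g \is a GRing.unit, a g \in Ag g,
    forall x, x \in Ag g <-> exists2 y, y \in P & x = a g * y &
    forall x, x \in Ag g <-> exists2 y, y \in P & x = y * a g].

Definition conj_act (O : idomainType) (A : unitAlgType O) (gT : finGroupType)
    (a : gT -> A) (g : gT) (x : A) : A := a g * x / a g.

(* The values of a linear character of G are roots of unity, hence lie in O   *)
(* when O is integrally closed; this gives them as elements of O, so that     *)
(* they can act on A.                                                         *)
Definition fraction_to_base (O : idomainType) (x : {fraction O}) : O :=
  xget 0 [set o : O | tofrac o = x].

(* The coefficients x_g in Abar of x = \sum_g x_g a_g. *)
Definition graded_coef (O : idomainType) (A : unitAlgType O) (P : {pred A})
    (Abar : subAlgType P) (gT : finGroupType) (a : gT -> A) (x : A) :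
    {ffun gT -> Abar} :=
  xget 0 [set c : {ffun gT -> Abar} | x = \sum_(g : gT) val (c g) * a g].

Definition dual_act (O : idomainType) (A : unitAlgType O) (P : {pred A})
    (Abar : subAlgType P) (gT : finGroupType) (a : gT -> A)
    (xi : dual_group {fraction O} gT) (x : A) : A :=
  \sum_(g : gT)
    fraction_to_base (xi g) *: (val (graded_coef Abar a x g) * a g).

(* Subalgebras of A are subsets of A here, so that blocks of different        *)
(* subalgebras can be compared.                                               *)
Definition alg_center (A : pzRingType) (S : set A) : set A :=
  [set z | S z /\ forall x, S x -> z * x = x * z].

Definition primitive_idempotent (A : pzRingType) (S : set A) (e : A) : Prop :=
  [/\ S e, e * e = e, e != 0 &
      forall e1 e2, S e1 -> S e2 -> e1 * e1 = e1 -> e2 * e2 = e2 ->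
        e1 * e2 = 0 -> e2 * e1 = 0 -> e = e1 + e2 -> e1 = 0 \/ e2 = 0].

Definition blocks (A : pzRingType) (S : set A) : set A :=
  [set e | primitive_idempotent (alg_center S) e].

Definition fixed_points (H A : Type) (act : H -> A -> A) (S : set A) : set A :=
  [set x | S x /\ forall h, act h x = x].

Definition orbit_of (H A : Type) (act : H -> A -> A) (x : A) : set A :=
  [set act h x | h in [set: H]].

Definition orbits (H A : Type) (act : H -> A -> A) (X : set A) : set (set A) :=
  [set orbit_of act x | x in X].

Definition orbit_sum (A : pzRingType) (Y : set A) : A := \sum_(x \in Y) x.

Definition stabilizer (H A : Type) (act : H -> A -> A) (x : A) : set H :=
  [set h | act h x = x].

Definition left_cosets (H : groupType) (S : set H) : set (set H) :=
  [set [set (h * s)%g | s in S] | h in [set: H]].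

(* For h in the coset C of the stabilizer of x, act h x depends only on C:    *)
(* [xget] extracts this common value.                                         *)
Definition rel_trace (H : groupType) (A : pzRingType) (act : H -> A -> A)
    (x : A) : A :=
  \sum_(C \in left_cosets (stabilizer act x)) xget 0 [set act h x | h in C].

(* Main.v *)
Require Import Defs.
From HB Require Import structures.
From mathcomp Require Import all_boot all_order all_algebra all_fingroup all_solvable.
From mathcomp Require Import generic_quotient.
From mathcomp Require Import boolp classical_sets functions cardinality fsbigop.
Set Implicit Arguments.
Unset Strict Implicit.
Unset Printing Implicit Defensive.

Import GRing.Theory.

Local Open Scope classical_set_scope.
Local Open Scope ring_scope.

(** Write [Z] for the center of [A] and [Zbar] for the center of the base [P].

    The heart of the matter is that the two fixed rings are literally equal:
    [Zbar^G = Z^(G^vee)] ([fixed_points_center]).  An element [x] of [Z] fixed by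
    every linear character satisfies [xi(g) x_g = x_g] for its components, and
    since [A] is torsion-free, [x_g = 0] as soon as some character has
    [xi(g) != 1].  When such a character exists for each [g != 1], [x] lies in
    [P], and an element of [P] is central in [A] if and only if it is central in
    [P] and commutes with the units [a_g], i.e. is fixed by [G].

    Linear characters separate the elements of an abelian [G] because its group
    algebra [KG] is split semisimple ([linear_characters_separate]): [KG] is a
    sum of simple ideals, on each of which [G] acts by scalars because [KG] is
    split and commutative; [g != 1] acts nontrivially on [KG], so nontrivially on
    one of these ideals.  The values of characters are roots of unity, so they lie
    in the integrally closed ring [O] and do act on [A].

    The rest is a general fact about a group acting on a commutative ring [C] in
    which orthogonal families of idempotents have bounded size: taking orbit sums
    is a bijection from the orbits on the primitive idempotents of [C] to the
    primitive idempotents of the fixed ring ([orbit_sum_bij]).  The bound holds in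
    a free module of finite rank over a domain ([free_bounded_idempotents]).
    Applying this to [G] on [Zbar] and to [G^vee] on [Z] gives two bijections onto
    the primitive idempotents of the same ring, hence the bijection between
    orbits with equal orbit sums; relative traces are orbit sums
    ([rel_traceE]). *)

(** * Primitive idempotents of a commutative subring *)

Section Orthogonality.
Variable B : pzRingType.

Definition orthogonal_idempotents (s : seq B) : Prop :=
  [/\ uniq s, {in s, forall x, x * x = x /\ x != 0} &
      {in s &, forall x y, x != y -> x * y = 0}].

(** The finiteness condition under which every nonzero idempotent dominates a
    primitive one and there are only finitely many primitive ones; it passes to subrings. *)
Definition bounded_idempotents : Prop :=
  exists N, forall s, orthogonal_idempotents s -> (size s <= N)%N.

Record commutative_subring (C : set B) : Prop := CommutativeSubring {
  csub0 : C 0;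
  csubB : forall x y, C x -> C y -> C (x - y);
  csubM : forall x y, C x -> C y -> C (x * y);
  csubC : forall x y, C x -> C y -> x * y = y * x
}.

Lemma alg_center_commutative (S : set B) :
  S 0 -> (forall x y, S x -> S y -> S (x - y)) ->
  (forall x y, S x -> S y -> S (x * y)) -> commutative_subring (alg_center S).
Proof.
move=> S0 SB SM; split.
- by split=> // x _; rewrite mul0r mulr0.
- move=> x y [Sx Zx] [Sy Zy]; split; first exact: SB.
  by move=> z Sz; rewrite mulrBl mulrBr Zx ?Zy.
- move=> x y [Sx Zx] [Sy Zy]; split; first exact: SM.
  by move=> z Sz; rewrite -mulrA Zy // mulrA Zx // mulrA.
- by move=> x y [_ Zx] [Sy _]; apply: Zx.
Qed.

End Orthogonality.

Section PrimitiveIdempotents.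
Variables (B : pzRingType) (C : set B).
Hypothesis CC : commutative_subring C.

Lemma csubN x : C x -> C (- x).
Proof. by move=> Cx; rewrite -sub0r; apply: (csubB CC) => //; apply: csub0. Qed.

Lemma csubD x y : C x -> C y -> C (x + y).
Proof. by move=> Cx Cy; rewrite -[y]opprK; apply/(csubB CC)/csubN. Qed.

Lemma csub_sum (s : seq B) : {in s, forall x, C x} -> C (\sum_(x <- s) x).
Proof.
elim: s => [|x s IH] Cs; first by rewrite big_nil; apply: csub0.
rewrite big_cons; apply: csubD; first exact/Cs/mem_head.
by apply: IH => y ys; apply: Cs; rewrite inE ys orbT.
Qed.

(** For idempotents [f <= e], the complement [e - f] is an idempotent orthogonal
    to [f]; a primitive [e] therefore leaves only the two extreme choices of [f]. *)
Lemma primitive_under e f : primitive_idempotent C e -> C f -> f * f = f ->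
  e * f = f -> f = 0 \/ f = e.
Proof.
move=> [Ce ee _ eP] Cf ff ef; have fe : f * e = f by rewrite (csubC CC).
case: (eP f (e - f)); rewrite ?mulrBl ?mulrBr ?ee ?ef ?ff ?fe ?subrr ?subr0 //.
- exact: (csubB CC).
- by rewrite addrC subrK.
- by left.
- by move=> /eqP; rewrite subr_eq0 => /eqP->; right.
Qed.

(** In a commutative ring the product of two primitive idempotents lies under
    both of them, so it can be nonzero only if they coincide. *)
Lemma primitive_orthogonal e f : primitive_idempotent C e ->
  primitive_idempotent C f -> e != f -> e * f = 0.
Proof.
move=> Pe Pf; have [Ce ee _ _] := Pe; have [Cf ff _ _] := Pf.
have Cef := csubM CC Ce Cf; have efC := csubC CC Ce Cf.
have efef : e * f * (e * f) = e * f.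
  by rewrite {2}efC mulrA -(mulrA e) ff -mulrA -efC mulrA ee.
case: (primitive_under Pe Cef efef); rewrite ?mulrA ?ee // => efe.
case: (primitive_under Pf Cef efef); rewrite ?mulrA -?efC -?mulrA ?ff // => eff.
by rewrite -{1}efe eff eqxx.
Qed.

Lemma primitive_family (s : seq B) : uniq s ->
  {in s, forall x, primitive_idempotent C x} -> orthogonal_idempotents s.
Proof.
move=> us Ps; split=> // [x xs|x y xs ys]; first by case: (Ps x xs).
exact: primitive_orthogonal (Ps _ xs) (Ps _ ys).
Qed.

Hypothesis B_bounded : bounded_idempotents B.

Lemma finite_primitive_idempotents : finite_set (primitive_idempotent C).
Proof.
have [N bN] := B_bounded.
apply: contrapT => /(infinite_set_fset N.+1)[s sP sz].
have os : orthogonal_idempotents (finmap.enum_fset s).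
  by apply: primitive_family; [exact: finmap.fset_uniq | move=> x /sP].
by have := leq_trans sz (bN _ os); rewrite ltnn.
Qed.

(** If no primitive idempotent lay under [e], any nonzero idempotent under [e]
    could be split again and again, which would produce orthogonal families of
    unbounded size. *)
Lemma primitive_under_idempotent e : C e -> e * e = e -> e != 0 ->
  exists2 b, primitive_idempotent C b & b * e = b.
Proof.
move=> Ce ee e0; apply: contrapT => noP.
have split_under f : C f -> f * f = f -> f != 0 -> f * e = f ->
    exists f1 f2, [/\ C f1, C f2, f1 * f1 = f1, f2 * f2 = f2 & f1 * f2 = 0]
      /\ [/\ f = f1 + f2, f1 != 0 & f2 != 0].
  move=> Cf ff f0 fe; apply: contrapT => nosplit; apply: noP; exists f => //.
  split=> // f1 f2 C1 C2 i1 i2 o12 _ fE.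
  have [->|n1] := eqVneq f1 0; first by left.
  have [->|n2] := eqVneq f2 0; first by right.
  by case: nosplit; exists f1, f2.
have [N bN] := B_bounded.
have [s [f [[_ fnz _ _] sz _ os _]]] : exists (s : seq B) (f : B),
    [/\ [/\ C f, f != 0, f * f = f & f * e = f], size s = N.+1,
     {in s, forall x, C x}, orthogonal_idempotents s &
     {in s, forall x, x * f = 0}].
  elim: N.+1 => [|n [s [f [[Cf f0 ff fe] sz Cs [us si so] sf]]]].
    by exists [::], e; split.
  have [f1 [f2 [[C1 C2 i1 i2 o12] [fE n1 n2]]]] := split_under f Cf ff f0 fe.
  have o21 : f2 * f1 = 0 by rewrite (csubC CC).
  have ff1 : f * f1 = f1 by rewrite fE mulrDl i1 o21 addr0.
  have ff2 : f * f2 = f2 by rewrite fE mulrDl i2 o12 add0r.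
  have sf1 x : x \in s -> x * f1 = 0 by move=> xs; rewrite -ff1 mulrA sf ?mul0r.
  exists (f1 :: s), f2; split.
  - by split=> //; rewrite -ff2 -mulrA (csubC CC C2 Ce) mulrA fe.
  - by rewrite /= sz.
  - by move=> x; rewrite inE => /orP[/eqP-> //|/Cs].
  - split.
    + rewrite /= us andbT; apply/negP => /sf1; rewrite i1.
      by move/eqP; rewrite (negPf n1).
    + by move=> x; rewrite inE => /orP[/eqP-> //|/si].
    + move=> x y; rewrite !inE => /orP[/eqP->|xs] /orP[/eqP->|ys].
      * by rewrite eqxx.
      * by rewrite (csubC CC C1 (Cs _ ys)) sf1.
      * by rewrite sf1.
      * exact: so.
  - move=> x; rewrite inE => /orP[/eqP-> //|xs].
    by rewrite -ff2 mulrA sf ?mul0r.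
by have := bN _ os; rewrite sz ltnn.
Qed.

End PrimitiveIdempotents.

(** * Orbit sums of primitive idempotents *)

Section Action.
Variables (H : groupType) (B : pzRingType) (act : H -> B -> B) (C : set B).

Record acts_by_automorphisms : Prop := ActsByAutomorphisms {
  act_in : forall h x, C x -> C (act h x);
  actD : forall h x y, C x -> C y -> act h (x + y) = act h x + act h y;
  actM : forall h x y, C x -> C y -> act h (x * y) = act h x * act h y;
  act1 : forall x, C x -> act 1%g x = x;
  actMg : forall g h x, C x -> act (g * h)%g x = act g (act h x)
}.

Hypothesis actC : acts_by_automorphisms.

Lemma actK h x : C x -> act h^-1%g (act h x) = x.
Proof. by move=> Cx; rewrite -(actMg actC) // mulVg (act1 actC). Qed.

Lemma actVK h x : C x -> act h (act h^-1%g x) = x.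
Proof. by move=> Cx; rewrite -(actMg actC) // mulgV (act1 actC). Qed.

Lemma orbit_of_refl x : C x -> orbit_of act x x.
Proof. by move=> Cx; exists 1%g => //; apply: act1. Qed.

Lemma orbit_of_eq x y : C x -> orbit_of act x y -> orbit_of act y = orbit_of act x.
Proof.
move=> Cx [h _ <-]; apply/seteqP; split=> _ [g _ <-].
  by exists (g * h)%g => //; rewrite (actMg actC).
by exists (g * h^-1)%g => //; rewrite (actMg actC) ?actK //; apply: act_in.
Qed.

(** Orbit-stabilizer: [h |-> act h x] induces a bijection from the cosets of the
    stabilizer of [x] to the orbit of [x], and the two sums correspond. *)
Lemma rel_traceE x : C x -> rel_trace act x = orbit_sum (orbit_of act x).
Proof.
move=> Cx; pose F (D : set H) := xget 0 [set act h x | h in D].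
pose coset h := [set (h * s)%g | s in stabilizer act x].
have FE h : F (coset h) = act h x.
  apply: xget_unique; first exists h => //.
    by exists 1%g; rewrite ?mulg1 //; apply: (act1 actC).
  by move=> _ [_ [s sx <-] <-]; rewrite (actMg actC) // sx.
rewrite /rel_trace /orbit_sum.
rewrite (@reindex_fsbig _ _ _ _ _ F (left_cosets (stabilizer act x))) //; split.
- by move=> _ [h _ <-]; rewrite FE; exists h.
- move=> D E /set_mem[g _ <-] /set_mem[h _ <-]; rewrite !FE => gh.
  have coset_sub g1 g2 : act g1 x = act g2 x -> coset g1 `<=` coset g2.
    move=> e _ [s sx <-]; exists (g2^-1 * (g1 * s))%g; last by rewrite mulKVg.
    by rewrite /stabilizer /= !(actMg actC) // sx e actK.
  by apply/seteqP; split; apply: coset_sub.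
- move=> _ [h _ <-]; exists (coset h); last exact: FE.
  by exists h.
Qed.

Hypothesis CC : commutative_subring C.

Lemma act0 h : act h 0 = 0.
Proof.
have C0 := csub0 CC.
by apply: (addrI (act h 0)); rewrite -(actD actC) // !addr0.
Qed.

Lemma actN h x : C x -> act h (- x) = - act h x.
Proof.
move=> Cx; apply: (addrI (act h x)); rewrite -(actD actC) ?subrr ?act0 //.
exact: (csubN CC).
Qed.

Lemma actB h x y : C x -> C y -> act h (x - y) = act h x - act h y.
Proof. by move=> Cx Cy; rewrite (actD actC) ?actN //; apply: (csubN CC). Qed.

Lemma act_sum h (s : seq B) : {in s, forall x, C x} ->
  act h (\sum_(x <- s) x) = \sum_(x <- s) act h x.
Proof.
elim: s => [|x s IH] Cs; first by rewrite !big_nil act0.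
have Cs' : {in s, forall x, C x} by move=> y ys; apply: Cs; rewrite inE ys orbT.
rewrite !big_cons (actD actC) ?IH //; first exact/Cs/mem_head.
exact: csub_sum.
Qed.

Lemma act_primitive h b :
  primitive_idempotent C b -> primitive_idempotent C (act h b).
Proof.
have key g x : C x -> act g x = 0 -> x = 0.
  by move=> Cx e; rewrite -(actK g Cx) e act0.
move=> [Cb bb b0 bP]; split.
- exact: act_in.
- by rewrite -(actM actC) ?bb.
- by apply: contra_neq b0; apply: key.
- move=> e1 e2 C1 C2 i1 i2 o12 o21 E.
  have Ci x : C x -> C (act h^-1%g x) by apply: act_in.
  case: (bP (act h^-1%g e1) (act h^-1%g e2)); rewrite -?(actM actC) -?(actD actC)//.
  + exact: Ci.
  + exact: Ci.
  + by rewrite i1.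
  + by rewrite i2.
  + by rewrite o12 act0.
  + by rewrite o21 act0.
  + by rewrite -E actK.
  + by move/key=> ->; auto.
  + by move/key=> ->; auto.
Qed.

Hypothesis B_bounded : bounded_idempotents B.

Lemma orbit_primitive Y : orbits act (primitive_idempotent C) Y ->
  [/\ Y `<=` primitive_idempotent C, finite_set Y,
      forall y, Y y -> orbit_of act y = Y,
      forall h y, Y y -> Y (act h y) & exists y, Y y].
Proof.
move=> [b Pb <-{Y}]; have [Cb _ _ _] := Pb.
have YP : orbit_of act b `<=` primitive_idempotent C.
  by move=> _ [h _ <-]; apply: act_primitive.
split=> //.
- exact: sub_finite_set YP (finite_primitive_idempotents CC B_bounded).
- by move=> y /(orbit_of_eq Cb).
- by move=> g _ [h _ <-]; exists (g * h)%g => //; rewrite (actMg actC).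
- by exists b; apply: orbit_of_refl.
Qed.

Lemma orbit_sumE (Y : set B) : finite_set Y ->
  orbit_sum Y = \sum_(y <- finmap.enum_fset (fset_set Y)) y.
Proof. exact: fsbig_finite. Qed.

(** Distinct primitive idempotents are orthogonal, so multiplying an orbit sum by
    one of them selects the corresponding term. *)
Lemma mul_orbit_sum Y b : orbits act (primitive_idempotent C) Y ->
  primitive_idempotent C b -> orbit_sum Y * b = if b \in Y then b else 0.
Proof.
move=> oY Pb; have [YP fY _ _ _] := orbit_primitive oY.
have [Cb bb _ _] := Pb.
have inY : (b \in Y) = (b \in finmap.enum_fset (fset_set Y)).
  by rewrite -(in_fset_set fY).
rewrite orbit_sumE // mulr_suml inY.
have PY y : y \in finmap.enum_fset (fset_set Y) -> primitive_idempotent C y.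
  by move=> yY; apply/YP/set_mem; rewrite -(in_fset_set fY).
have orth y : y \in finmap.enum_fset (fset_set Y) -> y != b -> y * b = 0.
  by move=> /PY Py; apply: (primitive_orthogonal CC Py Pb).
case: ifPn => [bY|bY].
  rewrite (bigD1_seq b) ?finmap.fset_uniq //= bb big_seq_cond big1 ?addr0 //.
  by move=> y /andP[/orth].
rewrite big_seq big1 // => y yY; apply: orth => //.
by apply: contraNneq bY => <-.
Qed.

Lemma orbit_sum_in Y : orbits act (primitive_idempotent C) Y -> C (orbit_sum Y).
Proof.
move=> oY; have [YP fY _ _ _] := orbit_primitive oY.
rewrite orbit_sumE //; apply: csub_sum => // y.
by rewrite (in_fset_set fY) => /set_mem/YP[].
Qed.

Lemma orbit_sum_fixed Y h : orbits act (primitive_idempotent C) Y ->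
  act h (orbit_sum Y) = orbit_sum Y.
Proof.
move=> oY; have [YP fY _ hY _] := orbit_primitive oY.
have CY y : Y y -> C y by move=> /YP[].
rewrite {1}orbit_sumE // act_sum => [|y]; last first.
  by rewrite (in_fset_set fY) => /set_mem/CY.
rewrite -(fsbig_finite _ (act h)) // /orbit_sum.
rewrite -(@reindex_fsbig _ _ _ _ _ (act h) Y Y id) //; split.
- by move=> y /(hY h).
- move=> x y /set_mem/CY Cx /set_mem/CY Cy e.
  by rewrite -(actK h Cx) e actK.
- by move=> y Yy; exists (act h^-1%g y); [apply: hY | apply/actVK/CY].
Qed.

Lemma orbit_sum_mul Y y : orbits act (primitive_idempotent C) Y -> Y y ->
  orbit_sum Y * y = y.
Proof.
move=> oY Yy; have [YP _ _ _ _] := orbit_primitive oY.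
by rewrite mul_orbit_sum ?(mem_set Yy) //; apply: YP.
Qed.

Lemma orbit_sum_idempotent Y : orbits act (primitive_idempotent C) Y ->
  orbit_sum Y * orbit_sum Y = orbit_sum Y.
Proof.
move=> oY; have [_ fY _ _ _] := orbit_primitive oY.
rewrite {2}orbit_sumE // mulr_sumr [RHS]orbit_sumE //.
apply: eq_big_seq => y; rewrite (in_fset_set fY) => /set_mem.
exact: orbit_sum_mul.
Qed.

(** The action permutes the primitive idempotents of [C] transitively within an
    orbit, so an invariant idempotent under the orbit sum contains all of the
    orbit or none of it: orbit sums stay primitive in the fixed ring, and every
    primitive invariant idempotent arises from the orbit of any primitive
    idempotent under it. *)
Theorem orbit_sum_bij :
  set_bij (orbits act (primitive_idempotent C))
          (primitive_idempotent (fixed_points act C)) (@orbit_sum B).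
Proof.
split.
- move=> Y oY; have [YP fY _ hY [b Yb]] := orbit_primitive oY.
  have sY := orbit_sum_mul oY.
  have Cs := orbit_sum_in oY.
  (* the group carries [b * e = 0] to the other elements of the orbit, since it
     fixes [e] *)
  have kill e : C e -> (forall h, act h e = e) -> b * e = 0 -> orbit_sum Y * e = 0.
    move=> Ce fe be; rewrite orbit_sumE // mulr_suml big_seq big1 // => y.
    rewrite (in_fset_set fY) => /set_mem.
    have [_ _ oE _ _] := orbit_primitive oY; rewrite -(oE b Yb) => -[h _ <-].
    by have [Cb _ _ _] := YP _ Yb; rewrite -(fe h) -(actM actC) // be act0.
  split.
  + by split=> // h; apply: orbit_sum_fixed.
  + exact: orbit_sum_idempotent.
  + apply/eqP => s0; have [_ _ /eqP b0 _] := YP _ Yb.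
    by apply: b0; rewrite -(sY _ Yb) s0 mul0r.
  + move=> e1 e2 [C1 f1] [C2 f2] i1 i2 o12 o21 sE.
    have [Cb bb _ bP] := YP _ Yb.
    have bC x : C x -> x * b = b * x by move=> Cx; apply: (csubC CC).
    have bxx x : C x -> x * x = x -> b * x * (b * x) = b * x.
      by move=> Cx xx; rewrite mulrA -(mulrA b x) bC // mulrA bb -mulrA xx.
    have bxy x y : C x -> x * y = 0 -> b * x * (b * y) = 0.
      by move=> Cx xy; rewrite mulrA -(mulrA b x) bC // mulrA bb -mulrA xy mulr0.
    have [|||||||be|be] := bP (b * e1) (b * e2); auto.
    * exact: (csubM CC).
    * exact: (csubM CC).
    * by rewrite -mulrDr -sE -bC // sY.
    * left; have := kill _ C1 f1 be; rewrite sE mulrDl i1 o21 addr0; exact.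
    * right; have := kill _ C2 f2 be; rewrite sE mulrDl i2 o12 add0r; exact.
- move=> Y Z /set_mem oY /set_mem oZ sE.
  have [YP _ oYE _ [b Yb]] := orbit_primitive oY.
  have [_ _ oZE _ _] := orbit_primitive oZ.
  have Pb := YP _ Yb; have [_ _ /eqP b0 _] := Pb.
  have := mul_orbit_sum oZ Pb.
  rewrite -sE (mul_orbit_sum oY Pb) (mem_set Yb).
  case: ifPn => [/set_mem Zb _|_ //]; by rewrite -(oYE b Yb) oZE.
- (* for [b] primitive under [e], the orbit sum [s] of [b] lies under the
     primitive [e], so that [e = s] *)
  move=> e Pe; have [[Ce fe] ee e0 eP] := Pe.
  have [b Pb be] := primitive_under_idempotent CC B_bounded Ce ee e0.
  have [Cb _ /eqP b0 _] := Pb.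
  have oY : orbits act (primitive_idempotent C) (orbit_of act b) by exists b.
  exists (orbit_of act b) => //.
  have [YP fY _ hY _] := orbit_primitive oY.
  set s := orbit_sum _.
  have Cs : C s := orbit_sum_in oY.
  have fs h : act h s = s by apply: orbit_sum_fixed.
  have Yb : orbit_of act b b := orbit_of_refl Cb.
  have sY := orbit_sum_mul oY.
  have ss : s * s = s := orbit_sum_idempotent oY.
  have se : s * e = s.
    rewrite /s orbit_sumE // mulr_suml; apply: eq_big_seq => y.
    rewrite (in_fset_set fY) => /set_mem[h _ <-].
    by rewrite -{1}(fe h) -(actM actC) // be.
  have es : e * s = s by rewrite (csubC CC).
  have [|||||||s0|/eqP] := eP s (e - s);
    rewrite ?mulrBl ?mulrBr ?ee ?se ?es ?ss ?subrr ?subr0 //.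
  + split; first exact: (csubB CC).
    by move=> h; rewrite actB // fe fs.
  + by rewrite addrC subrK.
  + by case: b0; have := sY _ Yb; rewrite -/s s0 mul0r => <-.
  + by rewrite subr_eq0 => /eqP.
Qed.

End Action.

(** * Orthogonal idempotents in free algebras *)

Section Fractions.
Variable O : idomainType.

Lemma fraction_numer_denom (x : {fraction O}) :
  exists (u v : O), v != 0 /\ tofrac u = tofrac v * x.
Proof.
elim/quotW: x => r; exists (frac r).1, (frac r).2; split; first exact: denom_ratioP.
rewrite -[_ * _]/(FracField.mul _ _) !piE; apply/eqmodP.
rewrite /= FracField.equivfE /FracField.mulf !numden_Ratio ?mul1r ?oner_neq0 //;
  try exact: denom_ratioP.
by rewrite mulrC.
Qed.

Lemma common_denominator m (x : 'I_m -> {fraction O}) :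
  exists (d : O) (y : 'I_m -> O),
    d != 0 /\ forall i, tofrac (y i) = tofrac d * x i.
Proof.
have [u uP] := choice (fun i => fraction_numer_denom (x i)).
have [v vP] := choice uP.
exists (\prod_i v i), (fun i => (\prod_(j | j != i) v j) * u i); split.
  by apply/prodf_neq0 => i _; have [] := vP i.
move=> i; have [_ uE] := vP i.
rewrite /= tofracM uE mulrA -tofracM; congr (tofrac _ * _).
by rewrite [RHS](bigD1 i) //= mulrC.
Qed.

(** A dependency exists over the fraction field by rank considerations, and
    clearing denominators makes it integral. *)
Lemma dependent_family m n (M : 'M[O]_(m, n)) : (n < m)%N ->
  exists2 c : 'rV[O]_m, c != 0 & c *m M = 0.
Proof.
move=> nm; pose MK := map_mx (@tofrac O) M.
have /rowV0Pn[u /sub_kermxP uM u0] : kermx MK != 0.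
  rewrite kermx_eq0 -row_leq_rank -ltnNge.
  exact: leq_ltn_trans (rank_leq_col _) nm.
have [d [y [d0 yE]]] := common_denominator (u 0).
have yu : map_mx (@tofrac O) (\row_i y i) = tofrac d *: u.
  by apply/rowP => i; rewrite !mxE yE.
exists (\row_i y i); first apply: contra_neq u0 => y0.
  apply/rowP => i; move/rowP/(_ i)/eqP: yu.
  rewrite y0 !mxE rmorph0 eq_sym mulf_eq0 tofrac_eq0 (negPf d0) /=.
  by move/eqP.
apply/matrixP => i j; rewrite [RHS]mxE; apply/eqP; rewrite -tofrac_eq0.
have /matrixP/(_ i j) : map_mx (@tofrac O) (\row_i y i *m M) = 0.
  by rewrite map_mxM yu -scalemxAl uM scaler0.
by rewrite [LHS]mxE mxE => /eqP; rewrite mxE.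
Qed.

End Fractions.

Section FreeModules.
Variable O : idomainType.

Lemma free_torsion_free (V : lmodType O) (c : O) (v : V) :
  free_of_finite_rank (fun (o : O) (x : V) => o *: x) ->
  c *: v = 0 -> c = 0 \/ v = 0.
Proof.
move=> [n [e eP]] cv; have [->|c0] := eqVneq c 0; [by left | right].
have [x [xE _]] := eP v; have [z [_ zU]] := eP (0 : V).
have x0 i : x i = 0.
  have: [ffun i => c * x i] = [ffun=> 0].
    transitivity z; [symmetry|]; apply: zU; last first.
      by rewrite big1 // => j _; rewrite ffunE scale0r.
    rewrite -[LHS]cv [in LHS]xE scaler_sumr; apply: eq_bigr => j _.
    by rewrite ffunE scalerA.
  by move/ffunP/(_ i)/eqP; rewrite !ffunE mulf_eq0 (negPf c0) /= => /eqP.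
by rewrite xE big1 // => i _; rewrite x0 scale0r.
Qed.

(** Nonzero orthogonal idempotents are linearly independent over the base: a
    relation [\sum_j c_j e_j = 0], multiplied by [e_k], gives [c_k e_k = 0].  A free
    module of rank [n] over a domain has no independent family of size above
    [n], as one sees over the fraction field. *)
Lemma free_bounded_idempotents (A : algType O) :
  free_of_finite_rank (fun (o : O) (x : A) => o *: x) -> bounded_idempotents A.
Proof.
move=> Afree; have [n [e eP]] := Afree; exists n => s [us si so].
rewrite leqNgt; apply/negP => ns.
have coordE x : exists c : {ffun 'I_n -> O}, x = \sum_(i < n) c i *: e i.
  by have [c [cE _]] := eP x; exists c.
have [coord cE] := choice coordE.
have [c /eqP c0 cM] := dependent_family
  (\matrix_(j < size s, i < n) coord s`_j i) ns.
have dep : \sum_(j < size s) c 0 j *: s`_j = 0.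
  under eq_bigr => j _ do rewrite [s`_j]cE scaler_sumr.
  rewrite exchange_big big1 //= => i _.
  under eq_bigr => j _ do rewrite scalerA.
  rewrite -scaler_suml; move/matrixP/(_ 0 i): cM; rewrite !mxE.
  by under eq_bigr => j _ do rewrite mxE; move->; rewrite scale0r.
apply: c0; apply/rowP => k; rewrite mxE.
have sk (j : 'I_(size s)) : s`_j \in s by apply: mem_nth.
have [ek k0] := si _ (sk k).
have := congr1 (fun x => x * s`_k) dep; rewrite mul0r mulr_suml (bigD1 k) //=.
rewrite -scalerAl ek big1 ?addr0 => [|j jk].
  by move/(free_torsion_free Afree) => [//|/eqP]; rewrite (negPf k0).
by rewrite -scalerAl so ?scaler0 // nth_uniq.
Qed.

End FreeModules.

(** * Characters separate the elements of an abelian group *)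

Section Submodule.
Variables (R : pzRingType) (V : lmodType R) (S : {pred V}).

(** A simple submodule is only a predicate on [V], whereas splitness speaks of
    modules; the closure proof is a parameter so that the type determines its
    module structure. *)
Record submodule (S_closed : submod_closed S) : Type := Submodule {
  submodule_val : V;
  submodule_valP : submodule_val \in S
}.

Variable S_closed : submod_closed S.
Local Notation W := (submodule S_closed).

HB.instance Definition _ := [isSub of W for @submodule_val S_closed].
HB.instance Definition _ := [Choice of W by <:].
HB.instance Definition _ :=
  GRing.SubChoice_isSubLmodule.Build R V S W (GRing.submod_closed_semi S_closed).

Lemma simple_submodule_module : simple_submodule S -> simple_module W.
Proof.
move=> [_ [v vS v0] Smin]; split.
- by split=> // a u w _ _.
- by exists (Submodule S_closed vS).
move=> T [T0 TZ] _.
pose T' : {pred V} := fun v => `[< exists2 w : W, w \in T & val w = v >].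
have T'E w : (val w \in T') = (w \in T).
  apply/asboolP/idP => [[w' w'T /val_inj <- //]|wT]; by exists w.
have [|||] := Smin T'.
- split; first by apply/asboolP; exists 0; rewrite ?raddf0.
  move=> r _ _ /asboolP[u uT <-] /asboolP[w wT <-].
  by apply/asboolP; exists (r *: u + w); [exact: TZ | rewrite linearP].
- by move=> _ /asboolP[w _ <-]; apply: submodule_valP.
- move=> T0'; left => w wT; apply/val_inj; rewrite [RHS]raddf0.
  by apply: T0'; rewrite T'E.
- by move=> ST; right => w _; rewrite -T'E; apply/ST/submodule_valP.
Qed.

End Submodule.

(** Commutativity makes left multiplication by [x] a module endomorphism of any
    ideal; on a simple ideal of a split algebra it is therefore a scalar. *)
Lemma split_scalar (K : fieldType) (B : algType K) (S : {pred B^o}) (x : B) :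
  split_algebra B -> (forall y z : B, y * z = z * y) -> simple_submodule S ->
  exists c : K, forall v : B, v \in S -> x * v = c *: v.
Proof.
move=> B_split B_comm S_simple; have [S_closed _ _] := S_simple.
pose W := submodule S_closed.
pose f (w : W) : W := x *: w.
have f_linear : linear f.
  move=> y u w; rewrite /f scalerDr; congr (_ + _).
  by rewrite !scalerA B_comm.
pose fL : {linear W -> W} := HB.pack f (GRing.isLinear.Build _ _ _ _ f f_linear).
have [c cE] := B_split W (simple_submodule_module S_closed S_simple) fL.
exists c => v vS; have /(congr1 val) := cE (Submodule S_closed vS).
by move=> xv; rewrite -[c *: v]mulr_algl; apply: xv.
Qed.

Section GroupAlgebraCharacters.
Variables (K : fieldType) (gT : finGroupType).
Local Notation KG := (group_algebra K gT).

Definition ga_delta (g : gT) : KG := [ffun x => (x == g)%:R].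

Lemma ga_deltaM g h : ga_delta g * ga_delta h = ga_delta (g * h)%g.
Proof.
apply/ffunP => x; rewrite [LHS]ffunE (bigD1 g) //= !ffunE eqxx mul1r.
rewrite big1 ?addr0 => [|y /negPf yg]; last by rewrite ffunE yg mul0r.
by rewrite -(inj_eq (mulgI g)) mulKVg.
Qed.

Lemma ga_delta1 : ga_delta 1%g = 1. Proof. by []. Qed.

Lemma ga_comm : abelian [set: gT]%SET -> forall f h : KG, f * h = h * f.
Proof.
move=> /centsP abG f h; apply/ffunP => g; rewrite !ffunE.
rewrite (reindex (fun x => (x^-1 * g)%g)) /=; last first.
  by exists (fun x => (g * x^-1)%g) => x _; rewrite invMg ?invgK ?mulKVg ?mulgKV.
apply: eq_bigr => x _; rewrite [LHS]mulrC; congr (h _ * f _).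
have comm (y z : gT) : (y * z)%g = (z * y)%g :=
  abG y (finset.in_setT y) z (finset.in_setT z).
by rewrite invMg invgK -mulgA (comm x) mulKg.
Qed.

(** Some simple ideal [S] of the group algebra is not killed by [g - 1], because
    these ideals span.  The group acts on [S] by scalars, which form a linear
    character taking a value other than [1] at [g]. *)
Lemma linear_characters_separate g : abelian [set: gT]%SET -> split_semisimple KG ->
  g != 1%g -> exists xi : dual_group K gT, xi g != 1.
Proof.
move=> abG [KG_ss KG_split] g1; have comm := ga_comm abG.
have [n [S [w [Sw wE]]]] := KG_ss (1 : KG).
have [i wi] : exists i, (ga_delta g - 1) * (w i : KG) <> 0.
  apply: contrapT => all0; have : ga_delta g - 1 = 0.
    rewrite -[LHS]mulr1 [X in _ * X]wE mulr_sumr big1 // => i _.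
    by apply: contrapT => wi; apply: all0; exists i.
  move/eqP; rewrite subr_eq0 => /eqP/ffunP/(_ g); rewrite !ffunE eqxx.
  by rewrite (negPf g1) => /eqP; rewrite oner_eq0.
have [S_simple wS] := Sw i.
have [c cE] := choice (fun h => split_scalar (ga_delta h) KG_split comm S_simple).
have w0 : w i != 0 by apply/eqP => w0; apply: wi; rewrite w0 mulr0.
have scal_inj : injective (fun x : K => x *: (w i : KG)).
  move=> x y /eqP; rewrite -subr_eq0 -scalerBl scaler_eq0 (negPf w0) orbF.
  by rewrite subr_eq0 => /eqP.
have c1 : c 1%g = 1 by apply: scal_inj; rewrite /= -cE // ga_delta1 mul1r scale1r.
have cM h k : c (h * k)%g = c h * c k.
  apply: scal_inj; rewrite /= -cE // -ga_deltaM -mulrA (cE k) //.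
  by rewrite -scalerAr cE // scalerA mulrC.
have chi : is_linear_character [ffun h => c h].
  apply/andP; split; apply/forallP => h.
    rewrite ffunE; apply/eqP => ch0; have := cM h h^-1%g.
    by rewrite mulgV c1 ch0 mul0r => /eqP; rewrite oner_eq0.
  by apply/forallP => k; rewrite !ffunE cM.
exists (DualGroup chi); rewrite ffunE; apply/eqP => cg1; apply: wi.
by rewrite mulrBl cE // cg1 scale1r mul1r subrr.
Qed.

End GroupAlgebraCharacters.

(** * The graded algebra and the two actions *)

Section LinearCharacters.
Variables (O : idomainType) (gT : finGroupType).
Hypothesis O_integrally_closed : integrally_closed O.
Implicit Types xi eta : dual_group {fraction O} gT.

Lemma dual_funM xi g h : xi (g * h)%g = xi g * xi h.
Proof. by case: xi => xi /= /andP[_ /forallP/(_ g)/forallP/(_ h)/eqP]. Qed.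

Lemma dual_fun1 xi : xi 1%g = 1.
Proof.
have xi0 : xi 1%g != 0 by case: xi => xi /= /andP[/forallP].
by apply: (mulfI xi0); rewrite -dual_funM mulg1 mulr1.
Qed.

(** The values of a linear character are roots of unity, hence integral. *)
Lemma tofrac_character xi g : tofrac (fraction_to_base (xi g)) = xi g.
Proof.
have xiX n : xi g ^+ n = xi (g ^+ n)%g.
  elim: n => [|n IH]; first by rewrite expg0 dual_fun1.
  by rewrite exprS IH expgS dual_funM.
have [|o oE] := O_integrally_closed (x := xi g).
  exists ('X^#[g]%g - 1%:P); first exact/monicXnsubC/order_gt0.
  rewrite rmorphB rmorphXn /= map_polyX map_polyC /= rmorph1 rootE !hornerE.
  by rewrite xiX expg_order dual_fun1 subrr.
by apply: (@xgetPex _ 0 [set o : O | tofrac o = xi g]); exists o.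
Qed.

Lemma tofrac_inj : injective (@tofrac O).
Proof. by move=> x y /eqP; rewrite tofrac_eq => /eqP. Qed.

Lemma base_characterM xi g h : fraction_to_base (xi (g * h)%g) =
  fraction_to_base (xi g) * fraction_to_base (xi h).
Proof.
by apply: tofrac_inj; rewrite tofracM !tofrac_character dual_funM.
Qed.

Lemma base_character1 xi : fraction_to_base (xi 1%g) = 1.
Proof. by apply: tofrac_inj; rewrite tofrac_character dual_fun1 tofrac1. Qed.

Lemma base_character_mul xi eta g : fraction_to_base ((xi * eta)%g g) =
  fraction_to_base (xi g) * fraction_to_base (eta g).
Proof. by apply: tofrac_inj; rewrite tofracM !tofrac_character ffunE. Qed.

Lemma base_character_one g :
  fraction_to_base ((1%g : dual_group {fraction O} gT) g) = 1.
Proof. by apply: tofrac_inj; rewrite tofrac_character ffunE tofrac1. Qed.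

End LinearCharacters.

Section GradedAlgebra.
Variables (O : idomainType) (A : unitAlgType O).
Variables (P : {pred A}) (Abar : subAlgType P).
Variables (gT : finGroupType) (Ag : gT -> {pred A}) (a : gT -> A).
Hypothesis Ag_closed : forall g, submod_closed (Ag g).
Hypothesis A_direct : forall x, exists! c : {ffun gT -> A},
  (forall g, c g \in Ag g) /\ x = \sum_(g : gT) c g.
Hypothesis AgM : forall g h x,
  x \in Ag (g * h)%g <-> in_product (Ag g) (Ag h) x.
Hypothesis Ag1 : Ag 1%g =i P.
Hypothesis a_units : graded_units P Ag a.

Local Notation G_act := (conj_act a).
Local Notation Gv_act := (dual_act Abar a).
Local Notation ZAbar := (alg_center [set` P]).
Local Notation ZA := (alg_center [set: A]).

Lemma Ag_mul g h x y : x \in Ag g -> y \in Ag h -> x * y \in Ag (g * h)%g.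
Proof.
move=> xg yh; apply/AgM; exists 1%N, (fun=> x), (fun=> y); split=> //.
by rewrite big_ord1.
Qed.

Lemma Ag0 g : 0 \in Ag g. Proof. by case: (Ag_closed g). Qed.

Lemma AgD g x y : x \in Ag g -> y \in Ag g -> x + y \in Ag g.
Proof. by case: (Ag_closed g) => _ AgL xg yg; rewrite -[x]scale1r AgL. Qed.

Lemma AgZ g (o : O) x : x \in Ag g -> o *: x \in Ag g.
Proof. by case: (Ag_closed g) => g0 AgL xg; rewrite -[_ *: _]addr0 AgL. Qed.

Lemma P_val x : x \in P -> exists u : Abar, val u = x.
Proof. by move=> Px; exists (Sub x Px); rewrite SubK. Qed.

Lemma P0 : 0 \in P. Proof. by rewrite -Ag1 Ag0. Qed.

Lemma PB x y : x \in P -> y \in P -> x - y \in P.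
Proof.
move=> /P_val[u <-] /P_val[v <-].
by rewrite -(rmorphB (val : Abar -> A)); apply: valP.
Qed.

Lemma PM x y : x \in P -> y \in P -> x * y \in P.
Proof.
move=> /P_val[u <-] /P_val[v <-].
by rewrite -(rmorphM (val : Abar -> A)); apply: valP.
Qed.

Definition component (x : A) (g : gT) : A :=
  val (graded_coef Abar a x g) * a g.

Lemma sum_component x : x = \sum_g component x g.
Proof.
have [c [[cg xE] _]] := A_direct x.
have coefE g : exists u : Abar, c g = val u * a g.
  have [_ _ _ AgE] := a_units.2 g.
  have [y /P_val[u <-] ->] := (AgE (c g)).1 (cg g).
  by exists u.
have [u uE] := choice coefE.
apply: (@xgetPex _ 0 [set c : {ffun gT -> Abar} | x = \sum_g val (c g) * a g]).
by exists (finfun u); rewrite /= xE; apply: eq_bigr => g _; rewrite uE ffunE.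
Qed.

Lemma component_in x g : component x g \in Ag g.
Proof.
have [_ _ _ AgE] := a_units.2 g.
by apply/AgE; exists (val (graded_coef Abar a x g)) => //; apply: valP.
Qed.

(** The components do not depend on the choice made in [graded_coef], by
    directness of the decomposition. *)
Lemma component_unique (c : gT -> A) : (forall g, c g \in Ag g) ->
  forall g, component (\sum_g c g) g = c g.
Proof.
move=> cg g; have [d [_ dU]] := A_direct (\sum_g c g).
have : finfun (component (\sum_g c g)) = finfun c.
  transitivity d; [symmetry|]; apply: dU; split=> [h|];
    rewrite ?ffunE ?component_in //.
  - by rewrite [LHS]sum_component; apply: eq_bigr => h _; rewrite ffunE.
  - by apply: eq_bigr => h _; rewrite ffunE.
by move/ffunP/(_ g); rewrite !ffunE.
Qed.

Lemma component_homogeneous g x : x \in Ag g ->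
  forall h, component x h = if h == g then x else 0.
Proof.
move=> xg h; pose c h := if h == g then x else 0.
have -> : x = \sum_h c h by rewrite /c -big_mkcond big_pred1_eq.
rewrite component_unique /c => [|k]; last by case: eqP => [->|_] //; apply: Ag0.
by rewrite -big_mkcond big_pred1_eq.
Qed.

Section DualAction.
Hypothesis O_integrally_closed : integrally_closed O.
Local Notation Gv := (dual_group {fraction O} gT).
Implicit Types (xi eta : Gv).
Local Notation chi xi g := (fraction_to_base (xi g)).

Lemma component_dual_act xi x g :
  component (Gv_act xi x) g = chi xi g *: component x g.
Proof. by rewrite component_unique // => h; apply/AgZ/component_in. Qed.

Lemma eq_component x y : component x =1 component y -> x = y.
Proof.
move=> e; rewrite (sum_component x) (sum_component y).
by apply: eq_bigr => g _; apply: e.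
Qed.

Lemma componentD x y g : component (x + y) g = component x g + component y g.
Proof.
rewrite {1}(sum_component x) {1}(sum_component y) -big_split component_unique //.
by move=> h; apply/AgD; apply: component_in.
Qed.

Lemma dual_actD xi x y : Gv_act xi (x + y) = Gv_act xi x + Gv_act xi y.
Proof.
apply: eq_component => g.
by rewrite componentD !component_dual_act componentD scalerDr.
Qed.

Lemma dual_act_homogeneous xi g x : x \in Ag g -> Gv_act xi x = chi xi g *: x.
Proof.
move=> xg; apply: eq_component => h.
rewrite component_dual_act !(component_homogeneous (g := g)) ?AgZ //.
by case: eqP => [->|_] //; rewrite scaler0.
Qed.

Lemma dual_act_sum (I : finType) xi (F : I -> A) :
  Gv_act xi (\sum_i F i) = \sum_i Gv_act xi (F i).
Proof.
apply: (big_morph _ (dual_actD xi)).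
by rewrite (dual_act_homogeneous xi (Ag0 1%g)) scaler0.
Qed.

Lemma dual_actM xi x y : Gv_act xi (x * y) = Gv_act xi x * Gv_act xi y.
Proof.
rewrite {1}(sum_component x) {1}(sum_component y) mulr_suml dual_act_sum.
rewrite [in RHS]/dual_act mulr_suml; apply: eq_bigr => g _.
rewrite mulr_sumr dual_act_sum mulr_sumr; apply: eq_bigr => h _.
rewrite (dual_act_homogeneous xi (g := (g * h)%g)); last first.
  by apply: Ag_mul; apply: component_in.
by rewrite base_characterM // -scalerAl -scalerAr scalerA.
Qed.

Lemma dual_act1 x : Gv_act 1%g x = x.
Proof.
apply: eq_component => g.
by rewrite component_dual_act base_character_one // scale1r.
Qed.

Lemma dual_actMg xi eta x : Gv_act (xi * eta)%g x = Gv_act xi (Gv_act eta x).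
Proof.
apply: eq_component => g.
by rewrite !component_dual_act base_character_mul // scalerA.
Qed.

Lemma dual_acts_center : acts_by_automorphisms Gv_act ZA.
Proof.
split=> [xi x [_ Zx]|xi x y _ _|xi x y _ _|x _|xi eta x _].
- split=> // z _.
  (* every [z] is in the image of the action, so [x z' = z' x] carries over *)
  by rewrite -[z]dual_act1 -(mulgV xi) dual_actMg -!dual_actM Zx.
- exact: dual_actD.
- exact: dual_actM.
- exact: dual_act1.
- exact: dual_actMg.
Qed.

Hypothesis A_free : free_of_finite_rank (fun (o : O) (x : A) => o *: x).
Hypothesis Gv_separates : forall g, g != 1%g -> exists xi : Gv, xi g != 1.

(** If [x] is fixed by the dual group, then [xi g *: x_g = x_g] for all [xi], so
    [x_g = 0] for [g != 1] by torsion-freeness. *)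
Lemma dual_fixed_in_base x : (forall xi, Gv_act xi x = x) -> x \in P.
Proof.
move=> fx; have x0 g : g != 1%g -> component x g = 0.
  move=> /Gv_separates[xi xig]; have := component_dual_act xi x g.
  rewrite fx => /esym/eqP; rewrite -subr_eq0 -{2}[component x g]scale1r -scalerBl.
  move=> /eqP/(free_torsion_free A_free)[/eqP|//]; rewrite subr_eq0 => /eqP chi1.
  by rewrite -tofrac_character // chi1 tofrac1 eqxx in xig.
rewrite (sum_component x) (bigD1 1%g) //= big1 ?addr0 => [|g /x0 //].
by rewrite -Ag1; apply: component_in.
Qed.

Lemma base_commutes_all x : x \in P -> (forall y, y \in P -> x * y = y * x) ->
  (forall g, G_act g x = x) -> forall y, x * y = y * x.
Proof.
move=> Px Zx fx y; rewrite (sum_component y) mulr_suml mulr_sumr.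
apply: eq_bigr => g _; have [ag _ _ _] := a_units.2 g.
rewrite mulrA Zx; last exact: valP.
rewrite -!mulrA; congr (_ * _).
by rewrite -{1}(fx g) /conj_act divrK.
Qed.

(** Both sides consist of the elements of [P] that are central in the whole
    algebra. *)
Lemma fixed_points_center : fixed_points G_act ZAbar = fixed_points Gv_act ZA.
Proof.
apply/seteqP; split=> [x [[Px Zx] fx]|x [[_ Zx] fx]].
  split; first by split=> // y _; apply: base_commutes_all.
  move=> xi; rewrite (dual_act_homogeneous xi (g := 1%g)) ?Ag1 //.
  by rewrite base_character1 // scale1r.
split; first by split; [exact: dual_fixed_in_base | move=> y _; apply: Zx].
by move=> g; have [ag _ _ _] := a_units.2 g; rewrite /conj_act -Zx // mulrK.
Qed.

End DualAction.

Lemma base_center_commutative : commutative_subring ZAbar.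
Proof. by apply: alg_center_commutative; [exact: P0|exact: PB|exact: PM]. Qed.

(** Although [a (g * h)] and [a g * a h] may differ, they differ by a factor in
    the base, with which central elements of the base commute. *)
Lemma conj_acts_center : acts_by_automorphisms G_act ZAbar.
Proof.
have aU g : a g \is a GRing.unit by have [] := a_units.2 g.
have conjP g x : x \in P -> G_act g x \in P.
  move=> Px; have [_ _ AgL AgR] := a_units.2 g.
  have /AgR[y Py e] : a g * x \in Ag g by apply/AgL; exists x.
  by rewrite /conj_act e mulrK.
have conjP' g y : y \in P -> exists2 x, x \in P & a g * x = y * a g.
  move=> Py; have [_ _ AgL AgR] := a_units.2 g.
  have /AgL[x Px e] : y * a g \in Ag g by apply/AgR; exists y.
  by exists x.
split=> [g x [Px Zx]|g x y _ _|g x y _ _|x _|g h x [Px Zx]].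
- split; first exact: conjP.
  move=> y Py; have [z Pz e] := conjP' g y Py.
  have yE : y = a g * z / a g by rewrite e mulrK.
  rewrite yE /conj_act !mulrA !divrK //; congr (_ / _).
  by rewrite -!mulrA Zx.
- by rewrite /conj_act mulrDr mulrDl.
- by rewrite /conj_act !mulrA divrK.
- by rewrite /conj_act a_units.1 mul1r divr1.
- have [_ _ AgL _] := a_units.2 (g * h)%g.
  have [_ ag _ _] := a_units.2 g; have [_ ah _ _] := a_units.2 h.
  have /AgL[u Pu e] := Ag_mul ag ah.
  apply: (mulIr (aU g)); apply: (mulIr (aU h)).
  rewrite -[LHS]mulrA e /conj_act !mulrA !divrK //.
  by rewrite e -!mulrA Zx.
Qed.

End GradedAlgebra.

(** * The bijection between orbits *)

Lemma matching_bij (T U : choiceType) (V : Type) (X : set T) (Y : set U) (Z : set V)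
    (f : T -> V) (g : U -> V) (u0 : U) :
  set_bij X Z f -> set_bij Y Z g ->
  exists phi, set_bij X Y phi /\ forall x, X x -> f x = g (phi x).
Proof.
move=> [fZ fI fS] [gZ gI gS].
pose phi x := xget u0 [set y | Y y /\ g y = f x].
have phiP x : X x -> Y (phi x) /\ g (phi x) = f x.
  move=> Xx; have [y Yy gy] := gS _ (fZ _ Xx).
  by apply: (@xgetPex _ u0 [set y | Y y /\ g y = f x]); exists y.
exists phi; split; last by move=> x /phiP[].
split.
- by move=> x /phiP[].
- move=> x y Xx Xy e; apply: fI => //.
  have [_ <-] := phiP _ (set_mem Xx); have [_ <-] := phiP _ (set_mem Xy).
  by rewrite e.
- move=> y Yy; have [x Xx fx] := fS _ (gZ _ Yy).
  exists x => //; have [Yp gp] := phiP _ Xx.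
  by apply: gI; rewrite ?inE // gp.
Qed.

Theorem proposition2p3p18
    (O : idomainType) (O_noetherian : noetherian O)
    (O_integrally_closed : integrally_closed O)
    (A : unitAlgType O) (t : {scalar A})
    (A_free : free_of_finite_rank (fun (o : O) (x : A) => o *: x))
    (t_symmetrizing : symmetrizing_form t)
    (P : {pred A}) (Abar : subAlgType P)
    (gT : finGroupType) (Ag : gT -> {pred A}) (a : gT -> A)
    (A_twisted : twisted_symmetric_algebra t Abar Ag)
    (a_units : graded_units P Ag a)
    (KA_split : split_semisimple_over_fractions A)
    (KAbar_split : split_semisimple_over_fractions Abar)
    (KG_split : split_semisimple (group_algebra {fraction O} gT))
    (G_cyclic : cyclic [set: gT]%SET) :
  let G_act := conj_act a in
  let Gv_act := dual_act Abar a in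
  let BlAbar := blocks [set` P] in
  let BlA := blocks [set: A] in
  (exists phi : set A -> set A,
     set_bij (orbits G_act BlAbar) (orbits Gv_act BlA) phi /\
     forall Ybar, orbits G_act BlAbar Ybar ->
       orbit_sum Ybar = orbit_sum (phi Ybar) /\
       forall bbar b, Ybar bbar -> phi Ybar b ->
         rel_trace G_act bbar = rel_trace Gv_act b) /\
  blocks (fixed_points G_act (alg_center [set` P])) =
    blocks (fixed_points Gv_act (alg_center [set: A])).
Proof.
move=> G_act Gv_act BlAbar BlA.
have [_ [Ag_closed A_direct AgM Ag1 _]] := A_twisted.
have abG : abelian [set: gT]%SET := cyclic_abelian G_cyclic.
have bA : bounded_idempotents A := free_bounded_idempotents A_free.
have CAbar := base_center_commutative Abar Ag_closed Ag1.
have CA : commutative_subring (alg_center [set: A]) by apply: alg_center_commutative.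
have actG := conj_acts_center AgM a_units.
have actGv := dual_acts_center Abar Ag_closed A_direct AgM a_units O_integrally_closed.
have fixE := fixed_points_center Abar Ag_closed A_direct Ag1 a_units
  O_integrally_closed A_free
  (fun g => @linear_characters_separate _ _ g abG KG_split).
split; last by rewrite fixE.
have bijG := orbit_sum_bij actG CAbar bA.
have bijGv := orbit_sum_bij actGv CA bA.
rewrite fixE in bijG.
have [phi [phi_bij phiE]] := matching_bij set0 bijG bijGv.
exists phi; split=> // Y oY; split; first exact: phiE.
have [phiY _ _] := phi_bij; have oZ := phiY _ oY.
move=> bbar b Yb Zb.
have [YP _ YE _ _] := orbit_primitive actG CAbar bA oY.
have [ZP _ ZE _ _] := orbit_primitive actGv CA bA oZ.
have [Cb _ _ _] := YP _ Yb; have [Cb' _ _ _] := ZP _ Zb.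
by rewrite (rel_traceE actG Cb) (rel_traceE actGv Cb') YE // ZE // phiE.
Qed.
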